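(* Let $p$ be an odd prime and $n$ a positive integer. Then $$S_{np}-S_n\equiv\begin{cases} 8n^2S_{n-1}(-1)^{\frac{p-1}{2}}p^2E_{p-3}\pmod{p^3} & \text{if } p>3 \text{ and } p\nmid n,\\ 9(n-1)S_n \pmod{p^3} & \text{if } p=3 \text{ and } 3\nmid n,\\ 0 \pmod{p^{3+\mathrm{ord}_p n}} & \text{if } p\mid n.\end{cases}$$
   Context: $(S_n)_{n\ge0}$ is the integer sequence defined by $S_0=1$, $S_1=4$ and $(n+1)^2S_{n+1}=4(3n^2+3n+1)S_n-32n^2S_{n-1}$ for $n\ge1$; equivalently $S_n=\sum_{k=0}^n\binom nk\binom{2k}k\binom{2n-2k}{n-k}$. The Euler numbers $E_n$ are defined by $E_0=1$, $E_{2n-1}=0$ and $\sum_{k=0}^n\binom{2n}{2k}E_{2k}=0$ for $n\ge1$. For a positive integer $n$, $\mathrm{ord}_p n$ is the largest integer $\alpha\ge0$ with $p^\alpha\mid n$. *)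

(* Defs.v *)
From HB Require Import structures.
From mathcomp Require Import all_boot all_order all_algebra.
Set Implicit Arguments. Unset Strict Implicit. Unset Printing Implicit Defensive.
Import Order.TTheory GRing.Theory Num.Theory.

Definition S (n : nat) : nat :=
  \sum_(k < n.+1) 'C(n, k) * 'C(2 * k, k) * 'C(2 * (n - k), n - k).

(* Euler numbers.  [eulers m] is the list [E_0; E_2; ...; E_(2m)], built
   from E_0 = 1 and E_(2m) = - sum_(k<m) C(2m,2k) E_(2k). *)
Definition euler_step (s : seq int) : seq int :=
  let m := size s in
  rcons s (- \sum_(k < m) (('C(2 * m, 2 * k))%:Z * nth 0%R s k))%R.

Definition eulers (m : nat) : seq int := iter m euler_step [:: 1%R].

Definition E (n : nat) : int :=
  if odd n then 0%R else nth 0%R (eulers n./2) n./2.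

Definition ord (p n : nat) : nat := logn p n.

(* Main.v *)
Require Import Defs.
From HB Require Import structures.
From mathcomp Require Import all_boot all_order all_algebra.
From mathcomp Require Import finfield.
From mathcomp Require Import zify ring.
Import Order.TTheory GRing.Theory Num.Theory.
Local Open Scope ring_scope.

(* Split S_(np), the sum of the terms t_N(k) = C(N,k) C(2k,k) C(2(N-k),N-k) with
   N = np, according to whether p divides k.

   If k = k'p, a Jacobsthal-type congruence for C((b+c)p,bp)/C(b+c,b) modulo
   p^3 c compares t_(np)(k'p) with t_n(k'); the error terms carry a factor k'
   or n-k', and both k' C(n,k') and (n-k') C(n,k') are multiples of n, so the
   comparison holds modulo p^3 n up to a correction that vanishes for p > 3.

   If k = ap+r with 0 < r < p/2 and a+b = n-1, writing factorials as powers of p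
   times their unit parts gives
     t_(np)(k) = p^2 n (2b+1) t_(n-1)(a) (2(-1)^r/r^2 + O(p)).
   The symmetry k <-> np-k covers the other residues, and summing yields
   4 p^2 n^2 S_(n-1) W with W the sum of (-1)^r/r^2 over 0 < r < p/2. Finally
   W = 2 (-1)^((p-1)/2) E_(p-3) mod p, by telescoping the identity
   G(y+1) + G(y-1) = 2 y^m for G(y) = sum_k C(m,k) E_k y^(m-k), m = p-3.

   Congruences modulo p^e m are equalities up to p^e m z in the rationals, with
   z p-integral; [ratr] into 'F_p is reduction modulo p on p-integral rationals. *)

(** * p-integral rationals and reduction modulo p *)

Definition pint (p : nat) : {pred rat} := fun x => coprime p `|denq x|.

Lemma denq_dvd (a d : int) : d != 0 -> (denq (a%:~R / d%:~R) %| d)%Z.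
Proof.
move=> d0; set x := (_ / _ : rat).
have e : numq x * d = a * denq x.
  apply: (@intr_inj rat); rewrite !rmorphM /= numqE /x.
  by field; rewrite intr_eq0.
rewrite -(@Gauss_dvdzr _ (numq x)); last by rewrite coprimezE coprime_sym coprime_num_den.
by rewrite e dvdz_mull.
Qed.

Lemma pint_frac {p : nat} (a d : int) : d != 0 -> coprime p `|d| ->
  a%:~R / d%:~R \in pint p.
Proof.
move=> d0 cpd; apply: coprime_dvdr cpd.
exact: (@denq_dvd a d d0).
Qed.

Fact pint_subring (p : nat) : subring_closed (pint p).
Proof.
have den x : x \in pint p -> denq x != 0 /\ coprime p `|denq x|.
  by rewrite denq_neq0.
split.
- by rewrite /in_mem /= /pint coprimen1.
- move=> x y /den[x0 cx] /den[y0 cy].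
  rewrite -[x]divq_num_den -[y]divq_num_den.
  have -> : (numq x)%:~R / (denq x)%:~R - (numq y)%:~R / (denq y)%:~R
     = (numq x * denq y - numq y * denq x)%:~R / (denq x * denq y)%:~R :> rat.
    by rewrite rmorphB !rmorphM /=; field; rewrite !intr_eq0 x0 y0.
  by apply: pint_frac; rewrite ?mulf_neq0 // abszM coprimeMr cx.
- move=> x y /den[x0 cx] /den[y0 cy].
  rewrite -[x]divq_num_den -[y]divq_num_den mulf_div -!rmorphM /=.
  by apply: pint_frac; rewrite ?mulf_neq0 // abszM coprimeMr cx.
Qed.

HB.instance Definition _ (p : nat) :=
  GRing.isSubringClosed.Build rat (pint p) (pint_subring p).

Lemma pint_invn {p m : nat} : (0 < m)%N -> coprime p m -> (m%:R : rat)^-1 \in pint p.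
Proof.
move=> m0 cpm; rewrite -div1r -[1]/(1%:~R) -[m%:R]/(m%:~R).
by apply: pint_frac; rewrite // -lt0n.
Qed.

(** The way back to integers: clear the denominator of z, prime to p, and apply Gauss. *)
Lemma pint_dvdz {p e : nat} (a : int) (z : rat) :
  z \in pint p -> a%:~R = (p%:R ^+ e) * z -> (p%:Z ^+ e %| a)%Z.
Proof.
move=> hz; rewrite -[z]divq_num_den => h.
have e2 : a * denq z = p%:Z ^+ e * numq z.
  apply: (@intr_inj rat); rewrite !rmorphM /= h rmorphXn /=.
  by field; rewrite intr_eq0 denq_neq0.
rewrite -(@Gauss_dvdzl _ _ (denq z)) ?e2 ?dvdz_mulr //.
by rewrite coprimezE abszX coprimeXl.
Qed.

Section Residue.

Context {p : nat} (p_pr : prime p).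

Local Notation red := (@ratr 'F_p).

Lemma Fp_nat_eq0 (m : nat) : (m%:R == 0 :> 'F_p) = (p %| m)%N.
Proof. by rewrite (dvdn_pcharf (pchar_Fp p_pr)). Qed.

Lemma Fp_int_eq0 (a : int) : (a%:~R == 0 :> 'F_p) = (p%:Z %| a)%Z.
Proof.
case: a => a; first by rewrite -[_%:~R]/(a%:R) Fp_nat_eq0.
by rewrite NegzE rmorphN oppr_eq0 /= Fp_nat_eq0.
Qed.

Lemma Fp_den_neq0 (d : int) : coprime p `|d| -> d%:~R != 0 :> 'F_p.
Proof. by rewrite Fp_int_eq0 dvdzE prime_coprime. Qed.

(** [ratr] reads the reduced fraction; cross-multiplying in ['F_p] shows that any fraction with
    denominator prime to p gives the same value. *)
Lemma red_frac (a d : int) : d != 0 -> coprime p `|d| ->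
  red (a%:~R / d%:~R) = a%:~R / d%:~R.
Proof.
move=> d0 cpd; rewrite /ratr; set x := (_ / _ : rat).
have e : numq x * d = a * denq x.
  apply: (@intr_inj rat); rewrite !rmorphM /= numqE /x.
  by field; rewrite intr_eq0.
have px : coprime p `|denq x| by apply: (@pint_frac p a d d0 cpd).
apply/eqP; rewrite eqr_div ?Fp_den_neq0 //.
by rewrite -!rmorphM /= e.
Qed.

Lemma red_add {x y : rat} : x \in pint p -> y \in pint p -> red (x + y) = red x + red y.
Proof.
move=> cx cy; rewrite -{1}[x]divq_num_den -{1}[y]divq_num_den.
have -> : (numq x)%:~R / (denq x)%:~R + (numq y)%:~R / (denq y)%:~R
     = (numq x * denq y + numq y * denq x)%:~R / (denq x * denq y)%:~R :> rat.
  by rewrite rmorphD !rmorphM /=; field; rewrite !intr_eq0 !denq_neq0.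
rewrite red_frac ?mulf_neq0 ?denq_neq0 // ?abszM ?coprimeMr; last by apply/andP.
rewrite /ratr rmorphD !rmorphM /=.
by field; rewrite !Fp_den_neq0.
Qed.

Lemma red_mul {x y : rat} : x \in pint p -> y \in pint p -> red (x * y) = red x * red y.
Proof.
move=> cx cy; rewrite -{1}[x]divq_num_den -{1}[y]divq_num_den mulf_div -!rmorphM /=.
rewrite red_frac ?mulf_neq0 ?denq_neq0 // ?abszM ?coprimeMr; last by apply/andP.
by rewrite !rmorphM /= /ratr; field; rewrite !Fp_den_neq0.
Qed.

Lemma red_sum (I : Type) (r : seq I) (P : pred I) (F : I -> rat) :
  (forall i, P i -> F i \in pint p) ->
  red (\sum_(i <- r | P i) F i) = \sum_(i <- r | P i) red (F i).
Proof.
move=> h.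
suff [_ ->] : \sum_(i <- r | P i) F i \in pint p /\
   red (\sum_(i <- r | P i) F i) = \sum_(i <- r | P i) red (F i) by [].
elim/big_rec2: _ => [|i y x Pi [px <-]]; first by rewrite rpred0 -[0]/(0%:~R) ratr_int.
by rewrite rpredD ?h // red_add ?h.
Qed.

Lemma red_eq0 {x : rat} : x \in pint p -> red x = 0 -> x / p%:R \in pint p.
Proof.
move=> px /eqP; rewrite /ratr mulf_eq0 invr_eq0 (negPf (Fp_den_neq0 _ px)) orbF.
rewrite Fp_int_eq0 => /dvdzP[q e].
have -> : x / p%:R = q%:~R / (denq x)%:~R.
  rewrite -{1}[x]divq_num_den e rmorphM /=.
  by field; rewrite intr_eq0 denq_neq0 pnatr_eq0 -lt0n prime_gt0.
by apply: pint_frac; rewrite ?denq_neq0.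
Qed.

(** Turns a computation in ['F_p] into an equality of rationals with a p-integral remainder, the
    form of the approximations below. *)
Lemma red_eq {x y : rat} : x \in pint p -> y \in pint p -> red x = red y ->
  exists2 z, z \in pint p & x = y + p%:R * z.
Proof.
move=> px py e; have p0 : p%:R != 0 :> rat by rewrite pnatr_eq0 -lt0n prime_gt0.
exists ((x - y) / p%:R); last by field.
apply: red_eq0; first exact: rpredB.
have := red_add (rpredB px py) py; rewrite subrK e.
by move/eqP; rewrite -subr_eq subrr => /eqP <-.
Qed.

Lemma red_fracn (a d : nat) : (0 < d)%N -> coprime p d ->
  red (a%:R / d%:R) = a%:R / d%:R.
Proof. by move=> d0 cd; rewrite (red_frac a d) // -lt0n. Qed.

Lemma pint_inv {x : rat} : x \in pint p -> red x != 0 -> x^-1 \in pint p.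
Proof.
move=> px; rewrite /ratr mulf_eq0 negb_or Fp_int_eq0 dvdzE => /andP[pn _].
rewrite -[x]divq_num_den invf_div; apply: pint_frac; last by rewrite prime_coprime.
by apply: contraNneq pn => ->; rewrite dvdn0.
Qed.

End Residue.

(** * Unit parts of factorials *)

(* The unit part of m! at p: the product of the j <= m prime to p. *)
Definition uf (p m : nat) : nat := \prod_(0 <= j < m.+1 | ~~ (p %| j)%N) j.

Lemma uf0 (p : nat) : uf p 0 = 1%N.
Proof. by rewrite /uf big_mkcond big_nat1 dvdn0. Qed.

Lemma ufS (p m : nat) :
  uf p m.+1 = (uf p m * if (p %| m.+1)%N then 1 else m.+1)%N.
Proof.
by rewrite /uf big_mkcond [in RHS]big_mkcond big_nat_recr //=; case: (p %| _)%N.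
Qed.

Lemma uf_fact (p m : nat) : (0 < p)%N ->
  (m`! = p ^ (m %/ p) * (m %/ p)`! * uf p m)%N.
Proof.
move=> p0; elim: m => [|m IHm]; first by rewrite div0n uf0.
rewrite factS ufS divnS // IHm; case: ifP => [/dvdnP[q e]|_]; last by rewrite add0n; nia.
have -> : (m %/ p)%N = q.-1.
  case: q e => [|q] e; first by rewrite mul0n in e.
  have -> : m = (q * p + p.-1)%N by rewrite mulSn in e; lia.
  by rewrite divnMDl // divn_small ?addn0 ?prednK.
case: q e => // q e; rewrite e /= add1n expnS factS; ring.
Qed.

Section UnitFactorial.

Context {p : nat} (p_pr : prime p).

Lemma uf_coprime (m : nat) : coprime p (uf p m).
Proof.
rewrite /uf; elim/big_ind: _ => [|x y cx cy|i]; first exact: coprimen1.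
- by rewrite coprimeMr cx.
- by rewrite prime_coprime.
Qed.

Lemma uf_gt0 (m : nat) : (0 < uf p m)%N.
Proof.
case: (posnP (uf p m)) => // e; have := uf_coprime m.
by rewrite e /coprime gcdn0 => /eqP p1; move: p_pr; rewrite p1.
Qed.

Lemma uf_neq0 (m : nat) : (uf p m)%:R != 0 :> rat.
Proof. by rewrite pnatr_eq0 -lt0n uf_gt0. Qed.

Lemma uf_Fp_neq0 (m : nat) : (uf p m)%:R != 0 :> 'F_p.
Proof. by rewrite Fp_nat_eq0 // -prime_coprime // uf_coprime. Qed.

Lemma wilson_Fp : (p.-1)`!%:R = -1 :> 'F_p.
Proof.
apply/eqP; rewrite -subr_eq0 opprK -(natrD _ _ 1) addn1 Fp_nat_eq0 //.
by rewrite -Wilson ?prime_gt1.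
Qed.

(** Each complete block of residues contributes (p-1)! = -1 by Wilson, and the last r factors
    contribute r!. *)
Lemma uf_Fp (a r : nat) : (r < p)%N ->
  (uf p (a * p + r))%:R = (-1) ^+ a * r`!%:R :> 'F_p.
Proof.
have step b s : (s.+1 < p)%N ->
    (uf p (b * p + s.+1))%:R = (uf p (b * p + s))%:R * s.+1%:R :> 'F_p.
  move=> sp; rewrite addnS ufS -addnS dvdn_addr ?dvdn_mull //.
  by rewrite gtnNdvd // natrM natrD natrM pchar_Fp_0 // mulr0 add0r.
elim: a r => [|a IHa] r.
  elim: r => [|r IHr] rp; first by rewrite uf0 mulr1.
  by rewrite step // IHr 1?ltnW // factS natrM mulrCA mulrA mulrC -!mulrA.
have p0 := prime_gt0 p_pr.
elim: r => [_|r IHr rp].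
  have e : (a.+1 * p + 0 = (a * p + p.-1).+1)%N by rewrite -addnS prednK //; lia.
  rewrite e ufS -e addn0 dvdn_mull // muln1 IHa ?prednK //.
  by rewrite wilson_Fp exprS !mulr1 mulrC.
by rewrite step // IHr 1?ltnW // factS natrM mulrCA mulrA mulrC -!mulrA.
Qed.

(** Induction from Wilson: the factor p - j, equal to -j modulo p, passes from the first factorial
    to the second. *)
Lemma fact_compl_Fp (j : nat) : (0 < j <= p)%N ->
  (p - j)`!%:R * (j.-1)`!%:R = (-1) ^+ j :> 'F_p.
Proof.
elim: j => // -[_ _|j IHj /andP[_ jp]]; first by rewrite subn1 wilson_Fp mulr1.
have := IHj (ltnW jp); rewrite -(subnSK jp) factS natrM (subnSK jp) => e.
rewrite exprS -e [in RHS]natrB 1?ltnW // pchar_Fp_0 // sub0r /=.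
by rewrite factS natrM; ring.
Qed.

End UnitFactorial.

(** * A Jacobsthal-type congruence *)

(* C((b+c)p, bp) / C(b+c, b), see [bin_ufq]. *)
Definition ufq (p b c : nat) : rat :=
  (uf p ((b + c) * p))%:R / ((uf p (b * p))%:R * (uf p (c * p))%:R).

Lemma prod_1D_mod2 (p : nat) (I : Type) (s : seq I) (P : pred I) (e : rat) (u : I -> rat) :
  e \in pint p -> (forall i, P i -> u i \in pint p) ->
  exists2 z, z \in pint p &
    \prod_(i <- s | P i) (1 + e * u i) = 1 + e * (\sum_(i <- s | P i) u i) + e ^+ 2 * z.
Proof.
move=> he hu.
suff [z [hz _ ez]] : exists z, [/\ z \in pint p, \sum_(i <- s | P i) u i \in pint p &
   \prod_(i <- s | P i) (1 + e * u i)
   = 1 + e * (\sum_(i <- s | P i) u i) + e ^+ 2 * z] by exists z.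
elim/big_rec2: _ => [|i y x Pi [z [hz hy ->]]]; first by exists 0; split; rewrite ?rpred0 //; ring.
exists (u i * y + (1 + e * u i) * z); split; last by ring.
  by rewrite rpredD ?rpredM ?rpredD ?rpred1 ?rpredM ?hu.
by rewrite rpredD ?hu.
Qed.

Section Jacobsthal.

Context {p : nat} (p_pr : prime p) (p_odd : odd p).

Let p0 : p%:R != 0 :> rat. Proof. by rewrite pnatr_eq0 -lt0n prime_gt0. Qed.

(** In the factorial formula the powers of p cancel, the factorials of the quotients by p form
    C(b+c, b), and the unit parts remain. *)
Lemma bin_ufq (b c : nat) :
  'C((b + c) * p, b * p)%:R = 'C(b + c, b)%:R * ufq p b c :> rat.
Proof.
have pp := prime_gt0 p_pr.
have := bin_fact (leq_addr c b); rewrite addKn => e1.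
have le : (b * p <= (b + c) * p)%N by rewrite leq_mul2r leq_addr orbT.
have := bin_fact le; rewrite -mulnBl addKn.
rewrite (uf_fact _ ((b + c) * p) pp) (uf_fact _ (b * p) pp) (uf_fact _ (c * p) pp).
rewrite !mulnK // -e1 => /(congr1 (fun x => x%:R : rat)).
rewrite !natrM expnD natrM !natrX /ufq => e.
have f x : x`!%:R != 0 :> rat by rewrite pnatr_eq0 -lt0n fact_gt0.
have u := uf_neq0 p_pr.
move: e (p0) (f b) (f c) (u (b * p)%N) (u (c * p)%N).
move: ((b`!)%:R) ((c`!)%:R) (uf p (b * p))%:R (uf p (c * p))%:R (uf p ((b + c) * p))%:R
  ('C((b + c) * p, b * p))%:R ('C(b + c, b))%:R (p%:R : rat).
move=> fb fc ub uc ud X Y P e P0 fb0 fc0 ub0 uc0.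
have h : P ^+ b * fb * ub * (P ^+ c * fc * uc) != 0 by rewrite !mulf_neq0 ?expf_neq0.
apply: (mulIf h); rewrite e; move: (P ^+ b) (P ^+ c) => Pb Pc.
by field; rewrite ub0 uc0.
Qed.

(** The factors of the numerator up to cp cancel; those beyond are cp + j with 0 < j <= bp. *)
Lemma ufq_prod (b c : nat) :
  ufq p b c = \prod_(0 <= j < (b * p).+1 | ~~ (p %| j)%N) ((c * p + j)%:R / j%:R).
Proof.
rewrite prodf_div /= -!natr_prod.
rewrite -/(uf p (b * p)) /ufq; have u := uf_neq0 p_pr.
have -> : uf p ((b + c) * p) =
  (uf p (c * p) * \prod_(0 <= j < (b * p).+1 | ~~ (p %| j)) (c * p + j))%N.
  rewrite {1}/uf (@big_cat_nat _ _ _ (c * p).+1) //=; last by rewrite ltnS leq_mul2r leq_addl orbT.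
  congr (_ * _)%N; have -> : (\prod_(0 <= j < (b * p).+1 | ~~ (p %| j)) (c * p + j) =
    \prod_(0 <= j < b * p | ~~ (p %| j.+1)) (c * p + j.+1))%N.
    by rewrite big_mkcond big_nat_recl // dvdn0 /= mul1n -big_mkcond.
  rewrite -[(c * p).+1]addn0 addnC big_addn.
  have -> : (((b + c) * p).+1 - (c * p).+1 = b * p)%N by lia.
  apply: eq_big => [j|j _]; last by lia.
  by rewrite addnS -addSn dvdn_addl // dvdn_mull.
move: (u (c * p)%N) (u (b * p)%N) => u1 u2.
by rewrite natrM (mulrC (uf p (b * p))%:R) -mulf_div mulfV // mul1r.
Qed.

Lemma prod_nat_sub (m : nat) (P : pred nat) (F : nat -> rat) :
  (forall j, (j <= m)%N -> P (m - j)%N = P j) ->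
  \prod_(0 <= j < m.+1 | P j) F j = \prod_(0 <= j < m.+1 | P j) F (m - j)%N.
Proof.
move=> h; rewrite big_nat_rev big_mkcond [RHS]big_mkcond.
by apply: eq_big_nat => j /andP[_ jm]; rewrite add0n subSS h.
Qed.

(* Squaring pairs the factors j and bp - j, so that the linear term in c p
   cancels and only p^2 survives. *)
Lemma ufq_sqr (b c : nat) :
  ufq p b c ^+ 2 = \prod_(0 <= j < (b * p).+1 | ~~ (p %| j)%N)
    (1 + (c * (b + c) * p ^ 2)%:R * (j * (b * p - j))%:R^-1).
Proof.
have hd j : (j <= b * p)%N -> (p %| b * p - j)%N = (p %| j)%N.
  by move=> le; rewrite dvdn_subr ?dvdn_mull.
have e2 := ufq_prod b c; rewrite prod_nat_sub in e2; last by move=> j /hd ->.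
rewrite expr2 {1}ufq_prod e2 -big_split /= big_mkcond [RHS]big_mkcond.
apply: eq_big_nat => j /andP[_]; rewrite ltnS => le; case: ifP => // pj.
have j0 : j%:R != 0 :> rat by rewrite pnatr_eq0; apply: contraNneq pj => ->.
have e : (b * p - j)%:R = b%:R * p%:R - j%:R :> rat by rewrite natrB // natrM.
have i0 : b%:R * p%:R - j%:R != 0 :> rat.
  by rewrite -e pnatr_eq0; move: pj; rewrite -hd //; apply: contraNneq => ->.
rewrite !natrM !natrD !natrM e.
move: (b%:R) (c%:R) (p%:R) (j%:R) j0 i0 => B C P J j0 i0.
by field; rewrite ?i0 ?j0.
Qed.

(* The term j = 0 contributes 0 since 0^-1 = 0. *)
Definition Hsq : 'F_p := \sum_(0 <= j < p) j%:R^-1 ^+ 2.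

(** Substituting 2x for x in the sum over ['F_p] gives Hsq = Hsq / 4, that is 3 Hsq = 0. *)
Lemma Hsq_eq0 : (3 < p)%N -> Hsq = 0.
Proof.
move=> p3; have pp := prime_gt1 p_pr.
have e : Hsq = \sum_(x : 'F_p) x^-1 ^+ 2.
  have h q : q = (Zp_trunc (pdiv p)).+2 ->
      \sum_(0 <= j < q) (j%:R^-1 ^+ 2 : 'F_p) = \sum_(x : 'F_p) x^-1 ^+ 2.
    by move=> ->; rewrite big_mkord; apply: eq_bigr => i _; rewrite natr_Zp.
  by apply: h; rewrite Fp_cast.
have two0 : 2%:R != 0 :> 'F_p by rewrite Fp_nat_eq0 // gtnNdvd // (ltn_trans _ p3).
have three0 : 3%:R != 0 :> 'F_p by rewrite Fp_nat_eq0 // gtnNdvd.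
have h : Hsq = 2%:R^-1 ^+ 2 * Hsq.
  rewrite {2}e mulr_sumr {1}e (reindex_inj (mulfI two0)) /=.
  by apply: eq_bigr => x _; rewrite invfM exprMn.
have : 3%:R * Hsq = 0.
  have -> : 3%:R = 2%:R ^+ 2 - 1 :> 'F_p by ring.
  by rewrite mulrBl mul1r {1}h; field.
by move/eqP; rewrite mulf_eq0 (negPf three0) => /eqP.
Qed.

(** Modulo p the factor bp - j is -j, so each of the b blocks of length p contributes -Hsq. *)
Lemma sum_inv_Fp (b : nat) :
  \sum_(0 <= j < (b * p).+1 | ~~ (p %| j)%N) ((j * (b * p - j))%:R^-1 : 'F_p)
  = - b%:R * Hsq.
Proof.
rewrite big_mkcond big_nat_recr //= dvdn_mull //= addr0 big_nat_mul.
rewrite (eq_big_nat _ _ (F2 := fun=> - Hsq)); last first.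
  move=> i /andP[_ ib]; rewrite -sumrN -{1}[(i * p)%N]add0n big_addn.
  rewrite mulSn addnK; apply: eq_big_nat => j /andP[_ jp].
  rewrite dvdn_addl ?dvdn_mull //.
  rewrite natrM; have -> : (b * p - (j + i * p))%:R = - j%:R :> 'F_p.
    rewrite natrB; last by nia.
    by rewrite natrD !natrM pchar_Fp_0 // !mulr0 addr0 sub0r.
  have -> : (j + i * p)%:R = j%:R :> 'F_p.
    by rewrite natrD natrM pchar_Fp_0 // mulr0 addr0.
  case: ifP => [_|/negbFE]; first by rewrite mulrN invrN invfM expr2.
  by rewrite -(Fp_nat_eq0 p_pr) => /eqP ->; rewrite invr0 expr0n oppr0.
by rewrite sumr_const_nat subn0 mulNr mulr_natl mulNrn.
Qed.

Lemma ufq_pint (b c : nat) : ufq p b c \in pint p.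
Proof.
rewrite /ufq -natrM rpredM ?rpred_nat //.
by rewrite pint_invn ?muln_gt0 ?uf_gt0 // coprimeMr !uf_coprime.
Qed.

Lemma ufq_Fp (b c : nat) : ratr (ufq p b c) = 1 :> 'F_p.
Proof.
rewrite /ufq -natrM red_fracn ?muln_gt0 ?uf_gt0 // ?coprimeMr ?uf_coprime //.
have h a : (uf p (a * p))%:R = (-1) ^+ a :> 'F_p.
  by rewrite -[(a * p)%N]addn0 uf_Fp ?prime_gt0 // mulr1.
by rewrite natrM !h exprD mulfV // mulf_neq0 // signr_eq0.
Qed.

(* Take g = 0 for p > 3 and g = -1 for p = 3. *)
Lemma ufq_jacobsthal (g : int) (b c : nat) : (2 * g)%:~R = - Hsq ->
  exists2 z, z \in pint p &
    ufq p b c = 1 + g%:~R * p%:R ^+ 2 * b%:R * c%:R * (b%:R + c%:R) + p%:R ^+ 3 * c%:R * z.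
Proof.
move=> hg; pose u j : rat := (j * (b * p - j))%:R^-1.
(* For j >= bp truncated subtraction makes the product 0, and then its inverse is 0 too. *)
have cu j : ~~ (p %| j)%N -> (j * (b * p - j) = 0)%N \/
    ((0 < j * (b * p - j))%N /\ coprime p (j * (b * p - j))).
  move=> pj; case: (leqP (b * p)%N j) => [le|lt].
    by left; rewrite (eqP le) muln0.
  right; rewrite muln_gt0 subn_gt0 lt coprimeMr !prime_coprime // pj.
  by rewrite dvdn_subr ?dvdn_mull ?(ltnW lt) // pj lt0n; split => //;
     rewrite andbT; apply: contraNneq pj => ->; rewrite dvdn0.
have hu j : ~~ (p %| j)%N -> u j \in pint p.
  by rewrite /u => /cu[->|[h1 h2]]; rewrite ?invr0 ?rpred0 ?pint_invn.
set s := \sum_(0 <= j < (b * p).+1 | ~~ (p %| j)%N) u j.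
have ps : s \in pint p by apply: rpred_sum.
have [z2 pz2 es] : exists2 z, z \in pint p & s = b%:R * (2 * g)%:~R + p%:R * z.
  apply: red_eq => //; first by rewrite rpredM ?rpred_nat ?rpred_int.
  rewrite red_mul ?rpred_nat ?rpred_int // ratr_nat ratr_int hg mulrN -mulNr -sum_inv_Fp.
  rewrite red_sum //; apply: eq_bigr => j /cu[e|[h1 h2]]; rewrite /u.
    by rewrite e !invr0 -[0 in LHS]/(0%:R) ratr_nat.
  by rewrite -div1r -[1]/(1%:R) red_fracn // div1r.
pose e : rat := c%:R * (b%:R + c%:R) * p%:R ^+ 2.
have pe : e \in pint p by rewrite !(rpredM, rpredD, rpredX, rpred_nat).
have [z1 pz1] := @prod_1D_mod2 p _ (index_iota 0 (b * p).+1) (fun j => ~~ (p %| j)%N) e u pe hu.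
have -> : e = (c * (b + c) * p ^ 2)%:R by rewrite !natrM natrD.
rewrite -ufq_sqr !natrM natrD -/s es => e2; rewrite intrM in e2.
have pq := ufq_pint b c.
(* Extraction of the square root: q = [ufq p b c] is 1 modulo p, so 1 + q is 2 modulo p, a unit as p
   is odd, and q - 1 = (q^2 - 1) / (1 + q). *)
have [w pw0 pw] : exists2 w, w \in pint p & ufq p b c = 1 + p%:R * w.
  by apply: red_eq; rewrite ?rpred1 // ufq_Fp -[1 in RHS]/(1%:R) ratr_nat.
have r2 : ratr (1 + ufq p b c) != 0 :> 'F_p.
  rewrite red_add ?rpred1 // ufq_Fp (ratr_nat _ 1) -(natrD _ 1 1) Fp_nat_eq0 //.
  by rewrite gtnNdvd // odd_prime_gt2.
have q0 : 1 + ufq p b c != 0.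
  by apply: contraNneq r2 => ->; rewrite -[0 in X in ratr X]/(0%:R) ratr_nat.
have pD : (1 + ufq p b c)^-1 \in pint p by rewrite (pint_inv p_pr) // rpredD ?rpred1.
exists ((b%:R + c%:R) * (z2 + c%:R * (b%:R + c%:R) * p%:R * z1 - g%:~R * b%:R * w)
         * (1 + ufq p b c)^-1).
  by rewrite !(rpredM, rpredB, rpredD, rpred_nat, rpred_int).
move: (ufq p b c) pw q0 e2 => q eq q0 e2; apply: (mulIf q0).
transitivity ((1 + g%:~R * p%:R ^+ 2 * b%:R * c%:R * (b%:R + c%:R)) * (1 + q) +
   p%:R ^+ 3 * c%:R * ((b%:R + c%:R) *
    (z2 + c%:R * (b%:R + c%:R) * p%:R * z1 - g%:~R * b%:R * w))); last by field.
have -> : q * (1 + q) = q ^+ 2 + q by ring.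
by rewrite e2 eq; ring.
Qed.

End Jacobsthal.

(** * The terms of S(np) *)

Definition term (n k : nat) : nat := 'C(n, k) * 'C(2 * k, k) * 'C(2 * (n - k), n - k).

Lemma S_sum (n : nat) : S n = (\sum_(0 <= k < n.+1) term n k)%N.
Proof. by rewrite big_mkord. Qed.

Lemma term_sym (n k : nat) : (k <= n)%N -> term n (n - k) = term n k.
Proof. by move=> le; rewrite /term bin_sub // subKn //; ring. Qed.

(** Absorption k C(n,k) = n C(n-1,k-1), the source of the factor n in the error terms. *)
Lemma mul_term (n k : nat) : exists x : nat, (k * term n k = n * x)%N.
Proof.
case: k => [|k]; first by exists 0%N; rewrite muln0.
exists ('C(n.-1, k) * 'C(2 * k.+1, k.+1) * 'C(2 * (n - k.+1), n - k.+1))%N.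
by rewrite /term !mulnA mul_bin_diag.
Qed.

Lemma pint_approx_sum (p : nat) (m : rat) (a b : nat) (F G : nat -> rat) :
  (forall i, (a <= i < b)%N -> exists2 z, z \in pint p & F i = G i + m * z) ->
  exists2 z, z \in pint p & \sum_(a <= i < b) F i = \sum_(a <= i < b) G i + m * z.
Proof.
move=> h; rewrite big_nat (big_nat _ _ a b G).
elim/big_rec2: _ => [|i x y Pi [z pz ->]].
  by exists 0; rewrite ?rpred0 ?mulr0 ?addr0.
have [z' pz' ->] := h i Pi.
by exists (z' + z); rewrite ?rpredD //; ring.
Qed.

Section Terms.

Context {p : nat} (p_pr : prime p) (p_odd : odd p).

(** The term is multiplied by three ratios [ufq]. Their main corrections add up to g p^2 (k c n + 2
    k^3 + 2 c^3) with c = n - k, which is g p^2 n (2 n^2 - 5 k c). *)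
Lemma term_mulp (g : int) (n k : nat) : (2 * g)%:~R = - Hsq (p := p) -> (k <= n)%N ->
  exists2 z, z \in pint p & (term (n * p) (k * p))%:R =
    (term n k)%:R + g%:~R * p%:R ^+ 2 * n%:R
      * ((term n k)%:R * (2 * n%:R ^+ 2 - 5 * k%:R * (n%:R - k%:R)))
    + p%:R ^+ 3 * n%:R * z.
Proof.
move=> hg le; pose c := (n - k)%N.
have en : n = (k + c)%N by rewrite subnKC.
have [x ex] := mul_term n k.
have [y ey] := mul_term n c; rewrite (term_sym n k le) in ey.
have [z1 p1 e1] := ufq_jacobsthal p_pr p_odd g k c hg.
have [z2 p2 e2] := ufq_jacobsthal p_pr p_odd g k k hg.
have [z3 p3 e3] := ufq_jacobsthal p_pr p_odd g c c hg.
have et : (term (n * p) (k * p))%:R =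
    (term n k)%:R * ufq p k c * ufq p k k * ufq p c c :> rat.
  rewrite /term -mulnBl -/c !(mulnA 2) !mul2n -!addnn en !natrM !bin_ufq //.
  by ring.
(* The ratios are 1 + p^2 c A1, 1 + p^2 k A2 and 1 + p^2 c A3. Every cross product keeps a factor c,
   so it goes with y in the witness. *)
pose A1 : rat := g%:~R * k%:R * n%:R + p%:R * z1.
pose A2 : rat := 2 * g%:~R * k%:R ^+ 2 + p%:R * z2.
pose A3 : rat := 2 * g%:~R * c%:R ^+ 2 + p%:R * z3.
have pA : [/\ A1 \in pint p, A2 \in pint p & A3 \in pint p].
  by split; rewrite /A1 /A2 /A3 !(rpred_nat, rpred_int, rpredX, rpredD, rpredM).
have [pA1 pA2 pA3] := pA.
exists (y%:R * (z1 + z3 + p%:R * (k%:R * A1 * A2 + c%:R * A1 * A3 + k%:R * A2 * A3)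
          + p%:R ^+ 3 * k%:R * c%:R * A1 * A2 * A3) + x%:R * z2).
  by rewrite !(rpred_nat, rpred_int, rpredX, rpredD, rpredM).
have nQ : n%:R = k%:R + c%:R :> rat by rewrite {1}en natrD.
have xQ : k%:R * (term n k)%:R = n%:R * x%:R :> rat by rewrite -!natrM ex.
have yQ : c%:R * (term n k)%:R = n%:R * y%:R :> rat by rewrite -!natrM ey.
have h (B C : rat) : n%:R * (y%:R * B + x%:R * C) =
    c%:R * (term n k)%:R * B + k%:R * (term n k)%:R * C.
  by rewrite xQ yQ; ring.
rewrite et e1 e2 e3 -[p%:R ^+ 3 * n%:R * _]mulrA h.
rewrite /A1 /A2 /A3 nQ.
move: (term n k)%:R (k%:R) (c%:R) (p%:R) (g%:~R) => T K C P G.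
ring.
Qed.

(** Put n = a+b+1, k = ap + r and k' = np - k = bp + (p-r). As 2k = 2ap + 2r and 2k' = (2b+1)p +
    (p-2r), extracting powers of p leaves a factor pn in C(np,k), none in C(2k,k) and p(2b+1) in
    C(2k',k'). The unit parts form U, reduced modulo p by Wilson. *)
Lemma term_residue (a b r : nat) : (0 < r)%N -> (2 * r < p)%N ->
  exists2 z, z \in pint p & (term ((a + b).+1 * p) (a * p + r))%:R =
     p%:R ^+ 2 * (a + b).+1%:R * ((2 * b).+1 * term (a + b) a)%:R
       * (2 * ((-1) ^+ r / r%:R ^+ 2) + p%:R * z).
Proof.
move=> r0 rp.
pose n := (a + b).+1; pose k := (a * p + r)%N; pose k' := (b * p + (p - r))%N.
have ekk : (n * p = k + k')%N by rewrite /n /k /k'; nia.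
pose U : rat := (uf p (n * p) * uf p (2 * k) * uf p (2 * k'))%:R / (uf p k ^ 3 * uf p k' ^ 3)%:R.
have cU : coprime p (uf p k ^ 3 * uf p k' ^ 3) by rewrite coprimeMr !coprimeXr ?uf_coprime.
have U0 : (0 < uf p k ^ 3 * uf p k' ^ 3)%N by rewrite muln_gt0 !expn_gt0 !uf_gt0.
have pU : U \in pint p by rewrite rpredM ?rpred_nat ?pint_invn.
have cr : coprime p (r ^ 2) by rewrite coprimeXr // prime_coprime // gtnNdvd //; lia.
have pr2 : r%:R ^- 2 \in pint p by rewrite -natrX pint_invn // expn_gt0 r0.
have pp := prime_gt0 p_pr.
have [z pz ez] : exists2 z, z \in pint p & U = 2 * ((-1) ^+ r / r%:R ^+ 2) + p%:R * z.
  have pm : (-1) ^+ r \in pint p by rewrite rpredX ?rpredN ?rpred1.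
  apply: (red_eq p_pr) => //; first by rewrite !rpredM ?rpred_nat.
  have -> : 2 * ((-1) ^+ r / r%:R ^+ 2) = (2 * (-1) ^+ r)%:~R / (r ^ 2)%N%:~R :> rat.
    by rewrite intrM rmorphXn /= mulrA -[(r ^ 2)%N%:~R]/((r ^ 2)%N%:R) natrX.
  rewrite red_frac //; last by rewrite -lt0n expn_gt0 r0.
  rewrite /U red_fracn //.
  have u0 := uf_Fp_neq0 p_pr.
  apply/eqP; rewrite eqr_div; last first.
  - by rewrite -[_%:~R]/((r ^ 2)%N%:R) Fp_nat_eq0 // -prime_coprime.
  - by rewrite Fp_nat_eq0 // -prime_coprime.
  rewrite -[(r ^ 2)%N%:~R]/((r ^ 2)%N%:R) intrM rmorphXn /=.
  rewrite !natrM ?natrX.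
  have -> : (uf p (n * p))%:R = (-1) ^+ n :> 'F_p.
    by rewrite -[(n * p)%N]addn0 uf_Fp // mulr1.
  have -> : (uf p (2 * k))%:R = (2 * r)`!%:R :> 'F_p.
    have -> : (2 * k = (2 * a) * p + 2 * r)%N by rewrite /k; lia.
    by rewrite uf_Fp // exprM sqrrN expr1n expr1n mul1r.
  have -> : (uf p (2 * k'))%:R = - (p - 2 * r)`!%:R :> 'F_p.
    have -> : (2 * k' = (2 * b).+1 * p + (p - 2 * r))%N by rewrite /k'; nia.
    by rewrite uf_Fp ?exprS ?exprM ?sqrrN ?expr1n ?expr1n ?mulN1r //; lia.
  rewrite /k /k' !uf_Fp //; [|lia|lia].
  have e1 : (p - r)`!%:R * (r.-1)`!%:R = (-1) ^+ r :> 'F_p by apply: fact_compl_Fp; lia.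
  have e2 : (p - 2 * r)`!%:R * ((2 * r).-1)`!%:R = 1 :> 'F_p.
    by rewrite fact_compl_Fp // ?exprM ?sqrrN ?expr1n //; lia.
  have f m : (0 < m)%N -> m`!%:R = m%:R * (m.-1)`!%:R :> 'F_p.
    by case: m => // m _; rewrite factS natrM.
  rewrite (f r r0) (f (2 * r)%N) ?muln_gt0 // natrM /n exprS exprD.
  have sq x : ((-1 : 'F_p) ^+ x) ^+ 2 = 1 by rewrite sqrr_sign.
  have := sq r; have := sq b; have := sq a.
  rewrite -[2%:~R]/(2%:R : 'F_p).
  move: ((-1) ^+ a) ((-1) ^+ b) ((-1) ^+ r) e1 => A B e.
  move: ((p - r)`!%:R) ((r.-1)`!%:R) ((p - 2 * r)`!%:R) (((2 * r).-1)`!%:R) e2.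
  move=> H f0 G F e2 e1 A2 B2 ee; apply/eqP.
  (* With denominators cleared, both sides are 2 A B r^3 times a factor equal to 1. *)
  transitivity ((G * F) * (2 * A * B * r%:R ^+ 3)); first by ring.
  transitivity ((e * (H * f0) ^+ 3) * A ^+ 2 * B ^+ 2 * (2 * A * B * r%:R ^+ 3)); last by ring.
  by rewrite e1 A2 B2 e2 !mulr1 -exprS (exprM e 2 2) ee expr1n.
exists z => //; rewrite -ez /U /term !natrM.
have u0 := uf_neq0 p_pr.
have f0 m : m`!%:R != 0 :> rat by rewrite pnatr_eq0 -lt0n fact_gt0.
have p0 : p%:R != 0 :> rat by rewrite pnatr_eq0 -lt0n.
have fk : k`!%:R = p%:R ^+ a * a`!%:R * (uf p k)%:R :> rat.
  by rewrite (uf_fact _ k pp) /k divnMDl // divn_small ?addn0 -?natrX -?natrM //; lia.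
have fk' : k'`!%:R = p%:R ^+ b * b`!%:R * (uf p k')%:R :> rat.
  by rewrite (uf_fact _ k' pp) /k' divnMDl // divn_small ?addn0 -?natrX -?natrM //; lia.
have -> : 'C(n * p, k)%:R =
    p%:R * n%:R * 'C(a + b, a)%:R * (uf p (n * p))%:R / ((uf p k)%:R * (uf p k')%:R) :> rat.
  have h : k`!%:R * k'`!%:R != 0 :> rat by rewrite mulf_neq0.
  apply: (mulIf h).
  have := @bin_fact (n * p) k; rewrite {1 3}ekk addKn leq_addr => /(_ isT)/(congr1 (fun x => x%:R : rat)).
  rewrite !natrM => ->; rewrite (uf_fact _ (n * p) pp) mulnK // fk fk' /n factS.
  have := bin_fact (leq_addr b a); rewrite addKn => <-.
  rewrite expnS expnD !natrM !natrX.
  move: (u0 k) (u0 k').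
  move: (p%:R ^+ a) (p%:R ^+ b) (a`!%:R) (b`!%:R) (uf p k)%:R (uf p k')%:R (uf p ((a + b).+1 * p))%:R 'C(_, _)%:R.
  move=> pa pb fa fb uk uk' un c1 uk0 uk'0.
  by field; rewrite uk0 uk'0.
have -> : 'C(2 * k, k)%:R =
    'C(2 * a, a)%:R * (uf p (2 * k))%:R / (uf p k)%:R ^+ 2 :> rat.
  have h : k`!%:R * k`!%:R != 0 :> rat by rewrite mulf_neq0.
  apply: (mulIf h).
  have := @bin_fact (k + k) k; rewrite addKn leq_addr addnn -mul2n => /(_ isT)/(congr1 (fun x => x%:R : rat)).
  rewrite !natrM => ->; rewrite (uf_fact _ (2 * k) pp) fk.
  have -> : ((2 * k) %/ p = a + a)%N.
    have -> : (2 * k = (a + a) * p + 2 * r)%N by rewrite /k; lia.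
    by rewrite divnMDl // divn_small ?addn0.
  have := bin_fact (leq_addr a a); rewrite addKn => <-.
  rewrite expnD addnn -mul2n !natrM !natrX.
  move: (u0 k).
  move: (p%:R ^+ a) (a`!%:R) (uf p k)%:R (uf p (2 * k))%:R 'C(_, _)%:R.
  by move=> pa fa uk u2k c1 uk0; field.
have -> : 'C(2 * (n * p - k), n * p - k)%:R =
    p%:R * (2 * b).+1%:R * 'C(2 * b, b)%:R * (uf p (2 * k'))%:R / (uf p k')%:R ^+ 2 :> rat.
  rewrite ekk addKn; have h : k'`!%:R * k'`!%:R != 0 :> rat by rewrite mulf_neq0.
  apply: (mulIf h).
  have := @bin_fact (k' + k') k'; rewrite addKn leq_addr addnn -mul2n => /(_ isT)/(congr1 (fun x => x%:R : rat)).
  rewrite !natrM => ->; rewrite (uf_fact _ (2 * k') pp) fk'.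
  have -> : ((2 * k') %/ p = (b + b).+1)%N.
    have -> : (2 * k' = (b + b).+1 * p + (p - 2 * r))%N by rewrite /k'; nia.
    by rewrite divnMDl // divn_small ?addn0 //; lia.
  rewrite factS; have := bin_fact (leq_addr b b); rewrite addKn => <-.
  rewrite expnS expnD addnn -mul2n !natrM !natrX.
  move: (u0 k').
  move: (p%:R ^+ b) (b`!%:R) (uf p k')%:R (uf p (2 * k'))%:R 'C(_, _)%:R.
  by move=> pa fa uk u2k c1 uk0; field.
rewrite addKn.
move: (u0 k) (u0 k') => uk0 uk'0.
move: (uf p k)%:R (uf p k')%:R uk0 uk'0 => uk uk' uk0 uk'0.
rewrite /n; move: (_.+1%:R) (_.+1%:R) (uf p _)%:R (uf p _)%:R (uf p _)%:R 'C(_, _)%:R 'C(_, _)%:R.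
move: 'C(_, _)%:R (p%:R) => c1 P N M x1 x2 x3 c2 c3.
by field; rewrite uk0 uk'0.
Qed.

End Terms.

(** * S(np) modulo p^3 n *)

Lemma sum_halves (h : nat) (F : nat -> nat) :
  (\sum_(1 <= r < (2 * h).+1) F r
   = \sum_(1 <= r < h.+1) F r + \sum_(1 <= r < h.+1) F ((2 * h).+1 - r))%N.
Proof.
rewrite (@big_cat_nat _ _ _ h.+1) //=; last by lia.
congr addn; rewrite [RHS]big_nat_rev /= -[h.+1]add1n big_addn.
have -> : ((2 * h).+1 - h = 1 + h)%N by lia.
by apply: eq_big_nat => i /andP[_ ih]; congr F; lia.
Qed.

(** The reflection of k to np - k sends residue p - r in block i to residue r in block n-1-i, whence
    the factor 2. *)
Lemma S_split (p n : nat) : odd p ->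
  S (n * p) = (\sum_(0 <= k < n.+1) term (n * p) (k * p)
     + 2 * \sum_(0 <= a < n) \sum_(1 <= r < p./2.+1) term (n * p) (a * p + r))%N.
Proof.
move=> op; have ep : p = (2 * p./2).+1 by rewrite mul2n -add1n -[1%N]/(nat_of_bool true) -op odd_double_half.
have p0 : (0 < p)%N by rewrite ep.
rewrite S_sum big_nat_recr //= big_nat_mul.
have -> : (\sum_(0 <= i < n) \sum_(i * p <= j < i.+1 * p) term (n * p) j =
   \sum_(0 <= i < n) (term (n * p) (i * p) + (\sum_(1 <= r < p./2.+1) term (n * p) (i * p + r)
     + \sum_(1 <= r < p./2.+1) term (n * p) (i * p + (p - r)))))%N.
  apply: eq_big_nat => i _.
  rewrite -{1}[(i * p)%N]add0n big_addn mulSn addnK big_ltn //= add0n; congr addn.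
  rewrite (eq_big_nat _ _ (F2 := fun r => term (n * p) (i * p + r))) => [|r _]; last by rewrite addnC.
  by rewrite [in LHS]ep sum_halves -ep.
rewrite !big_split /= [in RHS]big_nat_recr //= addnAC -!addnA; congr addn; congr addn.
rewrite mul2n -addnn; congr addn.
rewrite big_nat_rev /= add0n; apply: eq_big_nat => i /andP[_ lt]; apply: eq_big_nat => r /andP[r1 r2].
rewrite -term_sym; last by nia.
by congr term; nia.
Qed.

(** The symmetry of a and m - a averages the weights 2(m-a)+1 and 2a+1 to m+1. *)
Lemma sum_weight (m : nat) :
  (\sum_(0 <= a < m.+1) (2 * (m - a)).+1 * term m a = m.+1 * S m)%N.
Proof.
have e : (\sum_(0 <= a < m.+1) (2 * (m - a)).+1 * term m a
        = \sum_(0 <= a < m.+1) (2 * a).+1 * term m a)%N.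
  rewrite big_nat_rev; apply: eq_big_nat => a /andP[_ le].
  by rewrite add0n subSS subKn // term_sym.
apply/eqP; rewrite -(eqn_pmul2l (isT : 0 < 2)%N) {1}mul2n -addnn {1}e -big_split S_sum /=.
rewrite !big_distrr /=; apply/eqP; apply: eq_big_nat => a /andP[_ le].
rewrite -mulnDl mulnA; congr muln; lia.
Qed.

Definition Wsum (p : nat) : rat := \sum_(1 <= r < p./2.+1) (-1) ^+ r / r%:R ^+ 2.

Section Approximation.

Context {p : nat} (p_pr : prime p) (p_odd : odd p).

(** The factor 4 is 2 from the reflection times 2 from [term_residue]; [sum_weight] turns the sum
    over a into n S_(n-1). *)
Lemma S_mulp (g : int) (n : nat) : (2 * g)%:~R = - Hsq (p := p) -> (0 < n)%N ->
  exists2 z, z \in pint p & (S (n * p))%:R =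
    (S n)%:R
    + g%:~R * p%:R ^+ 2 * n%:R *
       (\sum_(0 <= k < n.+1) (term n k)%:R * (2 * n%:R ^+ 2 - 5 * k%:R * (n%:R - k%:R)))
    + 4 * p%:R ^+ 2 * n%:R ^+ 2 * (S n.-1)%:R * Wsum p
    + p%:R ^+ 3 * n%:R * z.
Proof.
move=> hg n0.
have [z1 pz1 e1] : exists2 z, z \in pint p & \sum_(0 <= k < n.+1) (term (n * p) (k * p))%:R =
   \sum_(0 <= k < n.+1) ((term n k)%:R + g%:~R * p%:R ^+ 2 * n%:R
      * ((term n k)%:R * (2 * n%:R ^+ 2 - 5 * k%:R * (n%:R - k%:R))))
    + p%:R ^+ 3 * n%:R * z.
  apply: pint_approx_sum => k /andP[_ le].
  exact: (term_mulp p_pr p_odd g n k hg le).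
have [z2 pz2 e2] : exists2 z, z \in pint p &
   \sum_(0 <= a < n) \sum_(1 <= r < p./2.+1) (term (n * p) (a * p + r))%:R =
   \sum_(0 <= a < n) p%:R ^+ 2 * n%:R * ((2 * (n.-1 - a)).+1 * term n.-1 a)%:R * (2 * Wsum p)
    + p%:R ^+ 3 * n%:R * z.
  apply: pint_approx_sum => a /andP[_ le].
  have [z pz ez] : exists2 z, z \in pint p &
     \sum_(1 <= r < p./2.+1) (term (n * p) (a * p + r))%:R =
     \sum_(1 <= r < p./2.+1) p%:R ^+ 2 * n%:R * ((2 * (n.-1 - a)).+1 * term n.-1 a)%:R
       * (2 * ((-1) ^+ r / r%:R ^+ 2)) + p%:R ^+ 3 * n%:R * z.
    apply: pint_approx_sum => r /andP[r0 rh].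
    have rp : (2 * r < p)%N by move: p_odd rh; rewrite -{2}(odd_double_half p) => ->; lia.
    have := term_residue p_pr p_odd a (n.-1 - a) r r0 rp.
    have -> : (a + (n.-1 - a) = n.-1)%N by lia.
    rewrite prednK // => -[z pz ->].
    exists (((2 * (n.-1 - a)).+1 * term n.-1 a)%:R * z); first by rewrite rpredM ?rpred_nat.
    by ring.
  by exists z => //; rewrite ez -!mulr_sumr.
exists (z1 + 2 * z2); first by rewrite rpredD ?rpredM ?rpred_nat.
set s1 := (S n)%:R; set s2 := (S n.-1)%:R.
rewrite S_split // natrD natrM !natr_sum (eq_bigr _ (fun i _ => natr_sum _ _ _ _)) e1 e2.
rewrite big_split /= -mulr_sumr -mulr_suml -mulr_sumr -!natr_sum -S_sum.
have := sum_weight n.-1; rewrite prednK // => ->; rewrite natrM -/s1 -/s2.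
by ring.
Qed.

End Approximation.

(** * Euler numbers modulo p *)

(** Each step only appends, so [E] can be read off any list that is long enough. *)
Lemma nth_eulers (m j : nat) : (j <= m)%N -> nth 0 (eulers m) j = E (2 * j).
Proof.
have sz k : size (eulers k) = k.+1.
  by elim: k => // k IHk; rewrite /eulers iterS -/(eulers k) /euler_step size_rcons IHk.
rewrite /E mul2n odd_double doubleK => /subnK <-; elim: (m - j)%N => // d IHd.
rewrite addSn /eulers iterS -/(eulers (d + j)) /euler_step nth_rcons sz.
by rewrite ltnS leq_addl IHd.
Qed.

Lemma E_odd (n : nat) : odd n -> E n = 0.
Proof. by rewrite /E => ->. Qed.

Lemma E_rec (m : nat) : E (2 * m.+1) = - \sum_(0 <= k < m.+1) 'C(2 * m.+1, 2 * k)%:Z * E (2 * k).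
Proof.
have sz k : size (eulers k) = k.+1.
  by elim: k => // k IHk; rewrite /eulers iterS -/(eulers k) /euler_step size_rcons IHk.
rewrite -(@nth_eulers m.+1) // /eulers iterS -/(eulers m) /euler_step nth_rcons sz ltnn eqxx.
rewrite big_mkord; congr (- _); apply: eq_bigr => k _.
by rewrite nth_eulers // -ltnS.
Qed.

Lemma sum_even (m : nat) (F : nat -> int) : (forall k, odd k -> F k = 0) ->
  \sum_(0 <= k < (2 * m).+1) F k = \sum_(0 <= k < m.+1) F (2 * k)%N.
Proof.
move=> h; elim: m => [|m IHm]; first by rewrite !big_nat1.
rewrite mulnS big_nat_recr // big_nat_recr // [RHS]big_nat_recr //= mulnS IHm.
by rewrite (h (2 * m).+1) ?addr0 //= mul2n odd_double.
Qed.

Lemma E_sum (m : nat) : (0 < m)%N -> ~~ odd m -> \sum_(0 <= k < m.+1) 'C(m, k)%:Z * E k = 0.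
Proof.
move=> m0 em; have [n en] : exists n, m = (2 * n.+1)%N.
  have := odd_double_half m; rewrite (negPf em) add0n.
  by case: (m./2) => [|n] e; [rewrite -e in m0 | exists n; rewrite mul2n].
rewrite en sum_even; last by move=> k /E_odd ->; rewrite mulr0.
by rewrite big_nat_recr //= binn mul1r E_rec addrN.
Qed.

(** Coefficientwise, this is (e^t + e^(-t)) sech t = 2. For odd m the sign factor kills every even
    k; for even m > 0 the recursion applies. *)
Lemma E_sum_sign (m : nat) :
  \sum_(0 <= k < m.+1) 'C(m, k)%:Z * E k * (1 + (-1) ^+ (m - k)) = (m == 0%N)%:R *+ 2.
Proof.
case: m => [|m]; first by rewrite big_nat1.
have h (c : int) k : (k <= m.+1)%N -> c * E k * (1 + (-1) ^+ (m.+1 - k)) =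
    c * E k * (1 + (-1) ^+ m.+1).
  move=> le; case ok: (odd k); first by rewrite E_odd // mulr0 !mul0r.
  by rewrite -[in LHS]signr_odd oddB // ok addbF signr_odd.
rewrite (eq_big_nat _ _ (F2 := fun k => 'C(m.+1, k)%:Z * E k * (1 + (-1) ^+ m.+1))); last first.
  by move=> k /andP[_ le]; rewrite h.
rewrite -mulr_suml -[(-1) ^+ _]signr_odd; case om: (odd m.+1); first by rewrite addrN mulr0.
by rewrite E_sum ?om // mul0r.
Qed.

(* G(y) = 2^m E_m((y+1)/2) for the Euler polynomial E_m. *)
Definition Gpoly (m : nat) (y : int) : int := \sum_(0 <= k < m.+1) 'C(m, k)%:Z * E k * y ^+ (m - k).

(** Both sides are m! / (k! i! (m-k-i)!), or 0 when k + i > m. *)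
Lemma bin_trinom (m k i : nat) : ('C(m, k) * 'C(m - k, i) = 'C(m, i) * 'C(m - i, k))%N.
Proof.
case: (leqP (k + i) m) => [le|lt]; last first.
  have z a b : (a <= m)%N -> (m < a + b)%N -> ('C(m, a) * 'C(m - a, b) = 0)%N.
    by move=> h1 h2; rewrite [X in (_ * X)%N]bin_small ?muln0 //; lia.
  case: (leqP k m) => km; last first.
    rewrite bin_small // mul0n; case: (leqP i m) => im; first by rewrite z // addnC.
    by rewrite bin_small.
  rewrite z //; case: (leqP i m) => im; first by rewrite z // addnC.
  by rewrite bin_small.
have h : (0 < k`! * i`! * (m - k - i)`!)%N by rewrite !muln_gt0 !fact_gt0.
have e1 := @bin_fact m k ltac:(lia); have e2 := @bin_fact (m - k) i ltac:(lia).
have e3 := @bin_fact m i ltac:(lia); have e4 := @bin_fact (m - i) k ltac:(lia).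
have e5 : (m - i - k = m - k - i)%N by lia.
apply/eqP; rewrite -(eqn_pmul2r h); apply/eqP.
rewrite e5 in e4; transitivity m`!.
  by rewrite -e1 -e2; ring.
by rewrite -e3 -e4; ring.
Qed.

Lemma sum_prefix (a b : nat) (F : nat -> int) : (a <= b)%N ->
  (forall i, (a <= i < b)%N -> F i = 0) ->
  \sum_(0 <= i < b) F i = \sum_(0 <= i < a) F i.
Proof.
by move=> le h; rewrite (@big_cat_nat _ _ _ a) //= (eq_big_nat _ _ h) big1_eq addr0.
Qed.

(** Expand both powers, with inner sums padded by zero binomials up to m, and exchange the sums. By
    [bin_trinom] the coefficient of y^i is C(m,i) times the sum of [E_sum_sign] for m - i, so only i
    = m survives. *)
Lemma Gpoly_sum (m : nat) (y : int) : Gpoly m (y + 1) + Gpoly m (y - 1) = 2 * y ^+ m.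
Proof.
have expand k (s : int) : (k <= m)%N -> (y + s) ^+ (m - k) =
    \sum_(0 <= i < m.+1) 'C(m - k, i)%:Z * y ^+ i * s ^+ (m - i - k).
  move=> le; rewrite addrC exprDn -(big_mkord xpredT (fun i => (s ^+ (m - k - i) * y ^+ i) *+ 'C(m - k, i))).
  rewrite [RHS](@sum_prefix (m - k).+1) ?ltnS ?leq_subr //; last first.
    by move=> i /andP[h _]; rewrite bin_small // !mul0r.
  apply: eq_big_nat => i _; rewrite -mulr_natl.
  have -> : (m - i - k = m - k - i)%N by lia.
  by rewrite natz mulrA mulrAC.
rewrite /Gpoly -big_split /=.
transitivity (\sum_(0 <= k < m.+1) \sum_(0 <= i < m.+1)
    y ^+ i * 'C(m, i)%:Z * ('C(m - i, k)%:Z * E k * (1 + (-1) ^+ (m - i - k)))).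
  apply: eq_big_nat => k /andP[_ le].
  rewrite !expand // !mulr_sumr -big_split; apply: eq_big_nat => i _ /=.
  have /(congr1 Posz) := bin_trinom m k i; rewrite !PoszM => e.
  rewrite expr1n.
  transitivity ('C(m, k)%:Z * 'C(m - k, i)%:Z * E k * y ^+ i * (1 + (-1) ^+ (m - i - k))); first by ring.
  by rewrite e; ring.
rewrite exchange_big /=.
transitivity (\sum_(0 <= i < m.+1) y ^+ i * 'C(m, i)%:Z * ((m - i == 0)%N%:R *+ 2)).
  apply: eq_big_nat => i /andP[_ le]; rewrite -mulr_sumr -E_sum_sign.
  congr (_ * _); apply: sum_prefix; first by rewrite ltnS leq_subr.
  by move=> k /andP[h _]; rewrite bin_small // !mul0r.
rewrite big_nat_recr //= subnn binn big_nat big1 ?add0r ?mulr1 1?mulrC //.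
by move=> i /andP[_ lt]; rewrite subn_eq0 leqNgt lt mul0rn mulr0.
Qed.

(** Telescoping: 2^(m+1) r^m = 2 (2r)^m is G(2r+1) + G(2r-1), and the alternating signs cancel the
    inner values. *)
Lemma Gpoly_alternating (m N : nat) : (0 < m)%N ->
  2 ^+ m.+1 * (\sum_(0 <= r < N.+1) (-1) ^+ r * r%:Z ^+ m) =
  Gpoly m (-1) + (-1) ^+ N * Gpoly m (2 * N).+1%:Z.
Proof.
move=> m0; elim: N => [|N IHN].
  rewrite big_nat1 expr0n eqn0Ngt m0 !mulr0 expr0 mul1r addrC.
  by have := Gpoly_sum m 0; rewrite expr0n eqn0Ngt m0 mulr0 add0r sub0r.
rewrite big_nat_recr //= mulrDr IHN.
have := Gpoly_sum m (2 * N.+1)%:Z.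
have -> : (2 * N.+1)%:Z + 1 = (2 * N.+1).+1%:Z by lia.
have -> : (2 * N.+1)%:Z - 1 = (2 * N).+1%:Z by lia.
rewrite PoszM exprMn => e.
have -> : 2 ^+ m.+1 * ((-1) ^+ N.+1 * N.+1%:Z ^+ m) = (-1) ^+ N.+1 * (2 * (2%:Z ^+ m * N.+1%:Z ^+ m)).
  by rewrite exprS; ring.
by rewrite -e exprS; ring.
Qed.

Lemma Gpoly_m1 (m : nat) : (0 < m)%N -> ~~ odd m -> Gpoly m (-1) = 0.
Proof.
move=> m0 em; rewrite -(E_sum m m0 em); apply: eq_big_nat => k /andP[_ le].
case ok: (odd k); first by rewrite E_odd // mulr0 mul0r.
by rewrite -signr_odd oddB // ok (negPf em) mulr1.
Qed.

Section EulerMod.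

Context {p : nat} (p_pr : prime p) (p_odd : odd p).

Lemma Gpoly_Fp (m : nat) : (Gpoly m p%:Z)%:~R = (E m)%:~R :> 'F_p.
Proof.
rewrite /Gpoly big_nat_recr //= rmorphD /= subnn binn mul1r mulr1 rmorph_sum /= big_nat big1 ?add0r //.
move=> k /andP[_ lt]; rewrite rmorphM /= rmorphXn /= -[p%:~R]/(p%:R) pchar_Fp_0 //.
by rewrite expr0n subn_eq0 leqNgt lt mulr0.
Qed.

Let ep : (p./2.*2.+1 = p)%N.
Proof. by rewrite -[RHS](odd_double_half p) p_odd. Qed.

Let cr r : (1 <= r < p./2.+1)%N -> coprime p (r ^ 2) /\ (0 < r ^ 2)%N.
Proof.
move=> /andP[r0 rh]; rewrite coprimeXr ?expn_gt0 ?r0 // prime_coprime // gtnNdvd //.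
by have := ep; lia.
Qed.

Let er r : (-1) ^+ r / r%:R ^+ 2 = ((-1) ^+ r)%:~R / ((r ^ 2)%N%:Z)%:~R :> rat.
Proof. by rewrite rmorphXn /= -[((r ^ 2)%N%:Z)%:~R]/((r ^ 2)%N%:R) natrX. Qed.

Let pr r : (1 <= r < p./2.+1)%N -> (-1) ^+ r / r%:R ^+ 2 \in pint p.
Proof. by move=> /cr[c1 c2]; rewrite er pint_frac // -lt0n. Qed.

Lemma Wsum_pint : Wsum p \in pint p.
Proof. by rewrite /Wsum big_nat rpred_sum. Qed.

(** Take m = p - 3 and N = (p-1)/2 in [Gpoly_alternating]: then 2N+1 = p, G(-1) = 0 and G(p) is E_m
    modulo p. By Fermat r^m is 1/r^2 and 2^(m+1) is 1/2. *)
Lemma Wsum_Fp : (3 < p)%N ->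
  ratr (Wsum p) = 2 * (-1) ^+ p./2 * (E (p - 3))%:~R :> 'F_p.
Proof.
move=> p3; rewrite /Wsum big_nat red_sum //.
have m0 : (0 < p - 3)%N by rewrite subn_gt0.
have em : ~~ odd (p - 3) by rewrite oddB 1?ltnW // p_odd.
have := Gpoly_alternating (p - 3) p./2 m0; rewrite Gpoly_m1 // add0r mul2n ep.
move/(congr1 (fun x => x%:~R : 'F_p)); rewrite !rmorphM /= Gpoly_Fp rmorphXn rmorphXn /= rmorph_sum /=.
set A := \sum_(_ <= _ < _) _; set B := \sum_(_ <- _ | _) _.
have -> : A = B.
  have z0 : (-1) ^+ 0 * 0%:Z ^+ (p - 3) = 0 by rewrite expr0n eqn0Ngt m0 mulr0.
  rewrite /A /B -big_nat [LHS]big_ltn // z0 mulr0z add0r; apply: eq_big_nat => r hr.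
  have [c1 c2] := cr r hr.
  rewrite er red_frac //; last by rewrite -lt0n.
  rewrite rmorphM /= !rmorphXn /= -[r%:~R]/(r%:R) -[((r ^ 2)%N%:Z)%:~R]/((r ^ 2)%N%:R) natrX.
  congr (_ * _).
  have r0 : r%:R != 0 :> 'F_p by rewrite Fp_nat_eq0 // -prime_coprime // -(@coprime_pexpr 2).
  (* Multiplying by r^3 reduces the claim to r^p = r. *)
  apply: (mulfI r0); apply: (mulfI r0); apply: (mulfI r0).
  rewrite -!exprS; have -> : (p - 3).+3 = p by lia.
  have := expf_card (r%:R : 'F_p); rewrite card_Fp // => ->.
  by field.
have two0 : 2%:R != 0 :> 'F_p by rewrite Fp_nat_eq0 // gtnNdvd // (ltn_trans _ p3).
have two : 2%:R ^+ (p - 3).+1 = 2%:R^-1 :> 'F_p.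
  apply: (mulfI two0); apply: (mulfI two0); rewrite -!exprS.
  have -> : (p - 3).+3 = p by lia.
  have := expf_card (2%:R : 'F_p); rewrite card_Fp // => ->.
  by rewrite mulfV // mulr1.
rewrite -[2%:~R]/(2%:R) two => e.
have -> : B = 2%:R * (2%:R^-1 * B) by rewrite mulrA mulfV // mul1r.
by rewrite e mulrN1z mulrA.
Qed.

End EulerMod.

(** * Lucas congruences and the case p = 3 *)

Section Lucas.

Context {p : nat} (p_pr : prime p).

(** Induction on r by Pascal's rule. For r = 0, the case s = 0 is [bin_ufq] with ratio 1 modulo p,
    and for s > 0 absorption gives s C(ap, bp+s) = 0 modulo p. *)
Lemma lucas_Fp (a b r s : nat) : (r < p)%N -> (s < p)%N ->
  'C(a * p + r, b * p + s)%:R = 'C(a, b)%:R * 'C(r, s)%:R :> 'F_p.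
Proof.
have pp := prime_gt0 p_pr.
elim: r b s => [|r IHr] b s rp sp.
  case: s sp => [|s] sp.
    rewrite !addn0 bin0 mulr1; case: (leqP b a) => [le|lt]; last first.
      by rewrite !bin_small // ltn_pmul2r.
    have e := bin_ufq p_pr b (a - b); rewrite subnKC // in e.
    have := congr1 (ratr : rat -> 'F_p) e.
    by rewrite red_mul ?rpred_nat ?ufq_pint // !ratr_nat ufq_Fp // mulr1.
  rewrite (@bin_small 0) // mulr0 addn0.
  have s0 : s.+1%:R != 0 :> 'F_p by rewrite Fp_nat_eq0 // gtnNdvd.
  apply: (mulfI s0); rewrite mulr0.
  have := congr1 (fun x => x%:R : 'F_p) (mul_bin_diag (a * p) (b * p + s)).
  rewrite /= !natrM pchar_Fp_0 // mulr0 mul0r -addnS => /esym.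
  by rewrite natrD natrM pchar_Fp_0 // mulr0 add0r.
have rp' := ltnW rp.
case: s sp => [|s] sp.
  (* Here Pascal's rule reaches into the previous block; the extra term contains C(r, p-1), zero
     since r < p - 1. *)
  rewrite !bin0 mulr1; case: b => [|b]; first by rewrite !bin0.
  have e : (b.+1 * p + 0 = (b * p + p.-1).+1)%N by rewrite -addnS prednK //; lia.
  rewrite addnS e binS -e natrD !IHr ?prednK // bin0 mulr1.
  by rewrite (@bin_small r) ?mulr0 ?addr0 // -ltnS prednK.
by rewrite !addnS binS natrD -addnS !IHr ?(ltnW sp) // binS natrD mulrDr.
Qed.

(** If 2r >= p, doubling carries and both sides vanish through C(2r-p, r) = 0. *)
Lemma lucas_central_Fp (a r : nat) : (r < p)%N ->
  'C(2 * (a * p + r), a * p + r)%:R = 'C(2 * a, a)%:R * 'C(2 * r, r)%:R :> 'F_p.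
Proof.
move=> rp; case: (ltnP (2 * r) p) => [lt|le].
  have -> : (2 * (a * p + r) = 2 * a * p + 2 * r)%N by lia.
  by rewrite lucas_Fp.
have tr : (2 * r - p < r)%N by lia.
have tp : (2 * r - p < p)%N by lia.
have z : 'C(2 * r - p, r) = 0%N by rewrite bin_small.
have -> : 'C(2 * r, r) = 'C(1 * p + (2 * r - p), 0 * p + r) by congr binomial; lia.
have -> : (2 * (a * p + r) = (2 * a).+1 * p + (2 * r - p))%N by nia.
by rewrite !lucas_Fp // z !mulr0.
Qed.

Lemma term_lucas (m e a r : nat) : (e < p)%N -> (r < p)%N -> (a <= m)%N ->
  (term (m * p + e) (a * p + r))%:R = (term m a)%:R * (term e r)%:R :> 'F_p.
Proof.
move=> ep rp am; rewrite /term !natrM lucas_Fp // lucas_central_Fp //.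
case: (leqP r e) => [re|er]; last by rewrite (@bin_small e) // !(mulr0, mul0r).
have -> : (m * p + e - (a * p + r) = (m - a) * p + (e - r))%N by nia.
rewrite lucas_central_Fp; last by lia.
by ring.
Qed.

(** Write k = ap + r: the weight depends only on r. Zero terms complete the range to whole
    blocks. *)
Lemma sum_term_lucas (m e : nat) (G : 'F_p -> 'F_p) : (e < p)%N ->
  \sum_(0 <= k < (m * p + e).+1) (term (m * p + e) k)%:R * G k%:R
  = (S m)%:R * \sum_(0 <= r < p) (term e r)%:R * G r%:R.
Proof.
move=> ep.
have -> : \sum_(0 <= k < (m * p + e).+1) (term (m * p + e) k)%:R * G k%:R
  = \sum_(0 <= k < m.+1 * p) (term (m * p + e) k)%:R * G k%:R.
  have le : ((m * p + e).+1 <= m.+1 * p)%N by nia.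
  rewrite [RHS](@big_cat_nat _ _ _ (m * p + e).+1) //=.
  rewrite [X in _ = _ + X](eq_big_nat _ _ (F2 := fun=> 0)) ?big1_eq ?addr0 //.
  by move=> k /andP[h _]; rewrite /term bin_small // !mul0n mul0r.
rewrite big_nat_mul S_sum natr_sum mulr_suml; apply: eq_big_nat => a /andP[_ am].
rewrite -{1}[(a * p)%N]add0n big_addn mulSn addnK mulr_sumr.
apply: eq_big_nat => r /andP[_ rp].
rewrite (addnC r) term_lucas // natrD natrM pchar_Fp_0 // mulr0 add0r.
by rewrite mulrA.
Qed.

End Lucas.

Lemma Hsq3 : Hsq (p := 3) = 2.
Proof. by rewrite /Hsq !big_nat_recr //= big_nil; apply/eqP. Qed.

Lemma Wsum3 : Wsum 3 = -1.
Proof. by rewrite /Wsum big_nat1; apply/eqP. Qed.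

(** For p = 3, g = -1 and W = -1, this is what remains of the claim modulo 27 after division by 9.
    Writing n = 3m + e, Lucas makes every summand S(m) times a constant depending on e. *)
Lemma S_mod3 (n : nat) : ~~ (3 %| n)%N ->
  (3 %| - n%:Z * (\sum_(0 <= k < n.+1) (term n k)%:Z * (2 * n%:Z ^+ 2 - 5 * k%:Z * (n%:Z - k%:Z)))
    - 4 * n%:Z ^+ 2 * (S n.-1)%:Z - (n%:Z - 1) * (S n)%:Z)%Z.
Proof.
move=> n3; have p3 : prime 3 by [].
rewrite -(@Fp_int_eq0 3 p3).
pose G (x : 'F_3) : 'F_3 := 2 * n%:R ^+ 2 - 5 * x * (n%:R - x).
set s0 := S n; set s1 := S n.-1.
rewrite !(rmorphB, rmorphM, rmorphN, rmorphXn) /=.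
have -> : (\sum_(0 <= k < n.+1) (term n k)%:Z * (2 * n%:Z ^+ 2 - 5 * k%:Z * (n%:Z - k%:Z)))%:~R
   = \sum_(0 <= k < n.+1) (term n k)%:R * G k%:R :> 'F_3.
  rewrite rmorph_sum; apply: eq_big_nat => k _.
  by rewrite /= !(rmorphB, rmorphM, rmorphN, rmorphXn) /=.
have h m e : (e < 3)%N -> (S (m * 3 + e))%:R = (S m)%:R * \sum_(0 <= r < 3) (term e r)%:R :> 'F_3.
  move=> e3; rewrite {1}S_sum natr_sum.
  have := sum_term_lucas p3 m e (fun=> 1) e3.
  rewrite (eq_bigr _ (fun k _ => mulr1 _)) => ->.
  by rewrite (eq_bigr _ (fun k _ => mulr1 _)).
rewrite -[n%:~R]/(n%:R) -[s0%:~R]/(s0%:R) -[s1%:~R]/(s1%:R) {}/s0 {}/s1.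
have en := divn_eq n 3; move: (ltn_pmod n (isT : 0 < 3)%N) n3.
rewrite /dvdn; move: (n %% 3)%N (n %/ 3)%N en => e m en e3 e0.
have hn : n%:R = e%:R :> 'F_3 by rewrite en natrD natrM (pchar_Fp_0 p3) mulr0 add0r.
have hS : (S n)%:R = (S m)%:R * \sum_(0 <= r < 3) (term e r)%:R :> 'F_3 by rewrite en h.
have hS' : (S n.-1)%:R = (S m)%:R * \sum_(0 <= r < 3) (term e.-1 r)%:R :> 'F_3.
  have -> : n.-1 = (m * 3 + e.-1)%N by move: e0; rewrite en; case: (e) => // *; rewrite addnS.
  by rewrite h // (leq_ltn_trans (leq_pred _)).
have hG : \sum_(0 <= k < n.+1) (term n k)%:R * G k%:R =
    (S m)%:R * \sum_(0 <= r < 3) (term e r)%:R * G r%:R :> 'F_3.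
  by rewrite {1 2}en; apply: sum_term_lucas.
rewrite hS hS' hG /G hn.
(* A finite check: e is 1 or 2, and S(m) takes three values in ['F_3]. *)
case: e e3 e0 {en hn hS hS' hG} => [|[|[|]]] // _ _; rewrite !big_nat_recr // !big_nil /=;
  by case: ((S m)%:R : 'F_3) => [[|[|[|x]]] hx]; vm_compute.
Qed.

(** * The three congruences, read off from the expansion modulo p^3 n *)

Theorem theorem3p1 (p n : nat) :
  prime p -> odd p -> (0 < n)%N ->
  [/\ (3 < p)%N -> ~~ (p %| n)%N ->
        ((S (n * p))%:Z - (S n)%:Z =
           8 * (n%:Z) ^+ 2 * (S n.-1)%:Z * (-1) ^+ ((p - 1) %/ 2)%N
             * (p%:Z) ^+ 2 * E (p - 3) %[mod (p%:Z) ^+ 3])%Z,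
      p = 3%N -> ~~ (3 %| n)%N ->
        ((S (n * p))%:Z - (S n)%:Z =
           9 * (n%:Z - 1) * (S n)%:Z %[mod (p%:Z) ^+ 3])%Z
    & (p %| n)%N ->
        ((S (n * p))%:Z - (S n)%:Z = 0 %[mod (p%:Z) ^+ (3 + ord p n)])%Z].
Proof.
move=> p_pr p_odd n0.
have p2 : (2 < p)%N by rewrite odd_prime_gt2.
have [g hg g0] : exists2 g : int, (2 * g)%:~R = - Hsq (p := p) & (3 < p)%N -> g = 0.
  case: (ltnP 3 p) => [p3|p3]; first by exists 0; rewrite // Hsq_eq0 // mulr0 oppr0.
  have e : p = 3%N by apply/eqP; rewrite eqn_leq p3.
  by rewrite e; exists (-1) => //; rewrite Hsq3.
have [z pz ez] := S_mulp p_pr p_odd g n hg n0.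
have cast : ((S (n * p))%:Z - (S n)%:Z)%:~R = (S (n * p))%:R - (S n)%:R :> rat by rewrite rmorphB.
have pW := Wsum_pint p_pr p_odd.
split.
- move=> p3 _; have Wr := Wsum_Fp p_pr p_odd p3.
  have -> : ((p - 1) %/ 2 = p./2)%N.
    by rewrite divn2 -{1}(odd_double_half p) p_odd add1n subn1 /= doubleK.
  (* An integer representative of W modulo p; its factor 2 and the 4 of [S_mulp] make the 8. *)
  pose w : int := 2 * (-1) ^+ p./2 * E (p - 3).
  have [y py ey] : exists2 y, y \in pint p & Wsum p = w%:~R + p%:R * y.
    apply: (red_eq p_pr) => //; first exact: rpred_int.
    by rewrite Wr ratr_int /w !rmorphM /= rmorphXn /=.
  apply/eqP; rewrite eqz_mod_dvd.
  apply: (@pint_dvdz p 3 _ (4 * n%:R ^+ 2 * (S n.-1)%:R * y + n%:R * z)).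
    by rewrite !(rpred_nat, rpredX, rpredD, rpredM).
  rewrite rmorphB /= cast ez ey g0 // /w.
  set s0 := S n; set s1 := S n.-1.
  by rewrite !rmorphM !rmorphXn /=; ring.
- move=> e n3; subst p.
  have h3 : (2 * (-1) : int)%:~R = - Hsq (p := 3) by rewrite Hsq3.
  have {z pz ez} [z pz ez] := S_mulp p_pr p_odd (-1) n h3 n0.
  have /dvdzP[q eq] := S_mod3 n n3.
  apply/eqP; rewrite eqz_mod_dvd.
  apply: (@pint_dvdz 3 3 _ (q%:~R + n%:R * z)).
    by rewrite !(rpred_nat, rpred_int, rpredX, rpredD, rpredM).
  rewrite rmorphB /= cast ez Wsum3.
  set s0 := S n in eq *; set s1 := S n.-1 in eq *.
  have {eq} := congr1 (fun x => x%:~R : rat) eq.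
  rewrite !(rmorphM, rmorphB, rmorphN, rmorphXn) /=.
  have -> : (\sum_(0 <= k < n.+1) (term n k)%:Z * (2 * n%:Z ^+ 2 - 5 * k%:Z * (n%:Z - k%:Z)))%:~R
    = \sum_(0 <= k < n.+1) (term n k)%:R * (2 * n%:R ^+ 2 - 5 * k%:R * (n%:R - k%:R)) :> rat.
    rewrite rmorph_sum; apply: eq_big_nat => k _.
    by rewrite /= !(rmorphB, rmorphM, rmorphXn) /=.
  move: (\sum_(_ <= _ < _) _) => X eq.
  (* Brings in 3q, the value given by [S_mod3], so that 9 times it is 27q. *)
  have -> : q%:~R = (q%:~R * 3%:R) / 3%:R :> rat by field.
  rewrite -[q%:~R * 3%:R]eq.
  by field.
- move=> /dvdnP[m em].
  (* Since p divides n, the weighted sum gains a factor p: n^2 is divisible by p, and k times the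
     term is a multiple of n. The W term gains one by writing n^2 as n m p. *)
  have [x px ex] : exists2 x, x \in pint p & \sum_(0 <= k < n.+1)
      (term n k)%:R * (2 * n%:R ^+ 2 - 5 * k%:R * (n%:R - k%:R))
      = \sum_(0 <= k < n.+1) 0 + p%:R * x.
    apply: pint_approx_sum => k /andP[_ le].
    have [y ey] := mul_term n k.
    exists (m%:R * (2 * (term n k)%:R * n%:R - 5 * y%:R * (n%:R - k%:R))).
      by rewrite !(rpred_nat, rpredM, rpredB, rpredN).
    have {}ey : k%:R * (term n k)%:R = n%:R * y%:R :> rat by rewrite -!natrM ey.
    transitivity ((term n k)%:R * 2 * n%:R ^+ 2 - 5 * (k%:R * (term n k)%:R) * (n%:R - k%:R) : rat).
      by ring.
    rewrite ey; have -> : n%:R = m%:R * p%:R :> rat by rewrite em natrM.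
    by ring.
  have [d ed] : exists d : nat, n = (p ^ logn p n * d)%N.
    by have /dvdnP[d ed] := pfactor_dvdnn p n; exists d; rewrite mulnC.
  apply/eqP; rewrite eqz_mod_dvd subr0 /ord.
  apply: (@pint_dvdz p _ _ (d%:R * (g%:~R * x + 4 * m%:R * (S n.-1)%:R * Wsum p + z))).
    by rewrite !(rpred_nat, rpred_int, rpredD, rpredM).
  rewrite cast ez ex big1_eq add0r.
  set s0 := S n; set s1 := S n.-1.
  transitivity (p%:R ^+ 3 * n%:R * (g%:~R * x + 4 * m%:R * s1%:R * Wsum p + z)).
    have -> : p%:R ^+ 3 * n%:R * (g%:~R * x + 4 * m%:R * s1%:R * Wsum p + z) =
      p%:R ^+ 3 * n%:R * (g%:~R * x + z) + 4 * p%:R ^+ 2 * n%:R * (m%:R * p%:R) * s1%:R * Wsum p by ring.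
    by rewrite -natrM -em; ring.
  by rewrite {1}ed natrM natrX exprD; ring.
Qed.
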